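(* Consider the system $\dot x=F(t,x,H(t)x)$, $(t,x)\in\mathbb R_{\ge0}\times\mathbb R^n$, with output $y=H(t)x\in\mathbb R^k$, where $H:\mathbb R_{\ge0}\to\mathbb R^{k\times n}$ is $C^0$ and $F:\mathbb R_{\ge0}\times\mathbb R^n\times\mathbb R^k\to\mathbb R^n$ is $C^0$ and locally Lipschitz in $(x,y)\in\mathbb R^n\times\mathbb R^k$. Let $M\subset\mathbb R^n$ be nonempty and closed with $0\in M$ and assume the system is $M$-forward complete, with bound $\beta\in NNN$. Assume that there exist an integer $\ell\in\mathbb N$, a map $A\in C^0(\mathbb R_{\ge0}\times\mathbb R^\ell\times\mathbb R^k;\mathbb R^{n\times n})$ and a constant $L>1$ such that for every $R>0$ the following two hypotheses hold. (A1) For every $t_0\ge0$ and $\xi>0$ there exists a set-valued map $[t_0,\infty)\ni t\mapsto Q_R(t)=Q_{R,t_0,\xi}(t)\subset\mathbb R^\ell$ satisfying the CP such that for every $t\ge t_0$, every $y\in Y_R(t):=\{y\in\mathbb R^k: y=H(t)x,\ |x|\le\beta(t,t_0,R)\}$ and all $x,z\in\mathbb R^n$ with $|x|\le\beta(t,t_0,R)$ and $|x-z|\le\xi$ one has $F(t,x,y)-F(t,z,y)=A(t,q,y)(x-z)$ for some $q\in Q_R(t)$. (A2') There exists a constant $\varepsilon_R>0$ (independent of $L$) such that for every $t_0\ge0$, $\xi>0$, with $Q_R=Q_{R,t_0,\xi}$, and for every $\bar t_0\ge t_0$ and $y=y(\cdot,t_0,x_0)\in Y(\mathbb R_{\ge0},M)\cap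 C^0([t_0,\infty);\mathbb R^k)$ there exist a time-varying symmetric matrix $P_R=P_{R,t_0,\bar t_0,\xi,y}\in C^1([\bar t_0,\infty);\mathbb R^{n\times n})$ and a function $d_R=d_{R,t_0,\bar t_0,\xi,y}\in C^0([\bar t_0,\infty);\mathbb R)$ with $$P_R(t)\ge I_{n\times n}\ \ \forall t\ge\bar t_0,\qquad |P_R(\bar t_0)|\le L,$$ $$\int_{\bar t_0}^t d_R(s)\,ds>-\varepsilon_R\ \ \forall t\ge\bar t_0,\qquad \int_{\bar t_0}^\infty d_R(s)\,ds=\infty,$$ and moreover, provided that $y\in Y(\mathbb R_{\ge0},B_R\cap M)\cap C^0([t_0,\infty);\mathbb R^k)$, $$e'P_R(t)A(t,q,y(t))e+\tfrac12e'\dot P_R(t)e\le-d_R(t)e'P_R(t)e\quad\forall t\ge\bar t_0,\ e\in\ker H(t),\ q\in Q_R(t);$$ in addition, for every $\bar t_0\ge t_0\ge0$ and $\xi>0$ the mappings $[\bar t_0,\infty)\times M\ni(t,x_0)\mapsto P_{R,t_0,\bar t_0,\xi,y(\cdot,t_0,x_0)}(t),\ d_{R,t_0,\bar t_0,\xi,y(\cdot,t_0,x_0)}(t)$ are continuous and causal with respect to $Y(\mathbb R_{\ge0},M)$. Then the S-SODP is solvable for the system with respect to $Y(\mathbb R_{\ge0},M)$.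
   Context: Notation: $|x|$ is the Euclidean norm, $|A|=\max\{|Ax|:|x|=1\}$ the induced matrix norm, $A'$ the transpose, $B_R$ the closed ball of radius $R$ centered at $0\in\mathbb R^n$; matrix inequalities are in the sense of quadratic forms. $N$ is the class of increasing continuous functions $\mathbb R_{\ge0}\to\mathbb R_{\ge0}$; $NNN$ is the class of continuous functions $\beta:(\mathbb R_{\ge0})^3\to\mathbb R_{\ge0}$ that belong to $N$ with respect to each of their three arguments. CP (Compactness Property): a set-valued map $[t_0,\infty)\ni t\mapsto Q(t)\subset\mathbb R^\ell$ satisfies the CP if for every sequence $t_\nu\to t$ in $[t_0,\infty)$ and $q_\nu\in Q(t_\nu)$ there are a subsequence $(q_{\nu_k})$ and $q\in Q(t)$ with $q_{\nu_k}\to q$. Forward completeness and outputs: $x(\cdot,t_0,x_0)$ is the solution of the system with $x(t_0)=x_0$. The system is $M$-forward complete if there is $\beta\in NNN$ with $|x(t,t_0,x_0)|\le\beta(t,t_0,|x_0|)$ for all $t\ge t_0\ge0$, $x_0\in M$; this $\beta$ is fixed. $y(t,t_0,x_0):=H(t)x(t,t_0,x_0)$, and for $I\subset\mathbb R_{\ge0}$, $Y(I,M)$ is the set of all outputs $y(\cdot,t_0,x_0):[t_0,\infty)\to\mathbb R^k$ with $(t_0,x_0)\in I\times M$. Causality: an object $a_{t_0,y}$ (a function of time $t$ in a subinterval of $[t_0,\infty)$ and possibly of further variables, possibly depending on further fixed parameters) assigned to each $y\in Y(\mathbb R_{\ge0},M)\cap C^0([t_0,\infty);\mathbb R^k)$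 is causal with respect to $Y(\mathbb R_{\ge0},M)$ if its value at time $t$ depends only on the values $y(s)$, $t_0\le s\le t$, of $y$ (it is independent of the future values $y(s)$, $s>t$). When, for every $y$, existence of a causal object is asserted, the objects are understood as such a family indexed by $y$. S-SODP (Strong Switching Observer Design Problem): it is solvable for the system with respect to $Y(\mathbb R_{\ge0},M)$ if for every $t_0\ge0$ and $y\in Y(\mathbb R_{\ge0},M)\cap C^0([t_0,\infty);\mathbb R^k)$ there exist: a strictly increasing sequence of times $(t_m)_{m\in\mathbb N}$ with $t_1=t_0$ and $\lim_{m\to\infty}t_m=\infty$; a sequence of continuous mappings $g_m=g_{m,t_m,y}(t,z,w):[t_{m-1},t_{m+1}]\times\mathbb R^n\times\mathbb R^k\to\mathbb R^n$, $m\in\mathbb N$, which are causal with respect to $Y(\mathbb R_{\ge0},M)$; and a nonempty set $\bar M\subset\mathbb R^n$, such that any solution $z_m(\cdot)$ of $\dot z_m=g_m(t,z_m,y(t))$ with $z_m(t_{m-1})\in\bar M$ is defined for each $t\in[t_{m-1},t_{m+1}]$, $m\in\mathbb N$, and, with $Z(t):=z_m(t)$ for $t\in[t_m,t_{m+1})$, $m\in\mathbb N$, one has $\lim_{t\to\infty}(x(t)-Z(t))=0$, where $x(\cdot)=x(\cdot,t_0,x_0)$, $x_0\in M$, is the trajectory of the system with output $y$. *)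

(* Defs.v *)
From HB Require Import structures.
From mathcomp Require Import all_boot all_order all_algebra.
From mathcomp Require Import all_classical all_reals all_analysis.

Set Implicit Arguments.
Unset Strict Implicit.
Unset Printing Implicit Defensive.

Import Order.TTheory GRing.Theory Num.Theory.
Import numFieldNormedType.Exports.

Local Open Scope classical_set_scope.
Local Open Scope ring_scope.

Definition enorm (R : realType) (n : nat) (x : 'cV[R]_n) : R :=
  Num.sqrt (\sum_(i < n) x i ord0 ^+ 2).

(* The supremum is attained: the unit sphere is compact (and nonempty if
   0 < n). *)
Definition opnorm (R : realType) (m n : nat) (A : 'M[R]_(m, n)) : R :=
  sup [set enorm (A *m v) | v in [set v : 'cV[R]_n | enorm v = 1]].

(* e' B e' *)
Definition qform (R : realType) (n : nat) (B : 'M[R]_n) (e : 'cV[R]_n) : R :=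
  (e^T *m B *m e) ord0 ord0.

Definition mx_ge (R : realType) (n : nat) (B C : 'M[R]_n) : Prop :=
  forall e : 'cV[R]_n, qform C e <= qform B e.

Definition eball (R : realType) (n : nat) (r : R) : set 'cV[R]_n :=
  [set x | enorm x <= r].

(* The closed half-line [a, +oo). *)
Definition halfline (R : realType) (a : R) : set R := [set t | a <= t].

(* Derivative at t of a function on J, which is one-sided at an endpoint of J
   that belongs to J. *)
Definition deriv_within (R : realType) (V : normedModType R) (J : set R)
    (f : R -> V) (t : R) (v : V) : Prop :=
  (fun s : R => (s - t)^-1 *: (f s - f t)) @ within J t^' --> v.

Definition C1_on (R : realType) (V : normedModType R) (J : set R)
    (f f' : R -> V) : Prop :=
  (forall t, J t -> deriv_within J f t (f' t)) /\ {within J, continuous f'}.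

Definition solves (R : realType) (V : normedModType R) (f : R -> V -> V)
    (J : set R) (z : R -> V) : Prop :=
  forall t, J t -> deriv_within J z t (f t (z t)).

(* Solutions on an interval J starting at a that cannot be continued within
   [a, b]. *)
Definition maximal_solution (R : realType) (V : normedModType R)
    (f : R -> V -> V) (a b : R) (J : set R) (z : R -> V) : Prop :=
  [/\ is_interval J, J a, J `<=` `[a, b]%classic, solves f J z &
      forall (J' : set R) (z' : R -> V),
        is_interval J' -> J `<=` J' -> J' `<=` `[a, b]%classic -> solves f J' z' ->
        (forall t, J t -> z' t = z t) -> J' = J].

Definition class_N (R : realType) (phi : R -> R) : Prop :=
  [/\ forall s, 0 <= s -> 0 <= phi s,
      {within halfline 0, continuous phi} &
      forall s s', 0 <= s -> s <= s' -> phi s <= phi s'].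

Definition class_NNN (R : realType) (beta : R -> R -> R -> R) : Prop :=
  [/\ {within [set p : R * R * R | [/\ 0 <= p.1.1, 0 <= p.1.2 & 0 <= p.2]],
         continuous (fun p => beta p.1.1 p.1.2 p.2)},
      forall b c, 0 <= b -> 0 <= c -> class_N (fun s => beta s b c),
      forall a c, 0 <= a -> 0 <= c -> class_N (fun s => beta a s c) &
      forall a b, 0 <= a -> 0 <= b -> class_N (fun s => beta a b s)].

(* The Lipschitz constant in (x, y) is locally uniform in (t, x, y). *)
Definition locally_lipschitz_xy (R : realType) (n k : nat)
    (F : R -> 'cV[R]_n -> 'cV[R]_k -> 'cV[R]_n) : Prop :=
  forall (t : R) (x : 'cV[R]_n) (y : 'cV[R]_k), 0 <= t ->
  exists delta C : R, 0 < delta /\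
    forall (s : R) (x1 x2 : 'cV[R]_n) (y1 y2 : 'cV[R]_k),
      0 <= s -> `|s - t| <= delta ->
      enorm (x1 - x) <= delta -> enorm (x2 - x) <= delta ->
      enorm (y1 - y) <= delta -> enorm (y2 - y) <= delta ->
      enorm (F s x1 y1 - F s x2 y2) <= C * (enorm (x1 - x2) + enorm (y1 - y2)).

(* X t t0 x0 stands for x(t, t0, x0); it is meaningful for t0 <= t and x0 \in M
   only. *)
Definition is_flow (R : realType) (n k : nat)
    (F : R -> 'cV[R]_n -> 'cV[R]_k -> 'cV[R]_n) (H : R -> 'M[R]_(k, n))
    (M : set 'cV[R]_n) (X : R -> R -> 'cV[R]_n -> 'cV[R]_n) : Prop :=
  forall (t0 : R) (x0 : 'cV[R]_n), 0 <= t0 -> M x0 ->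
    X t0 t0 x0 = x0 /\
    solves (fun t x => F t x (H t *m x)) (halfline t0) (fun t => X t t0 x0).

Definition forward_complete (R : realType) (n : nat) (M : set 'cV[R]_n)
    (X : R -> R -> 'cV[R]_n -> 'cV[R]_n) (beta : R -> R -> R -> R) : Prop :=
  class_NNN beta /\
  forall (t t0 : R) (x0 : 'cV[R]_n), 0 <= t0 -> t0 <= t -> M x0 ->
    enorm (X t t0 x0) <= beta t t0 (enorm x0).

Definition output (R : realType) (n k : nat) (H : R -> 'M[R]_(k, n))
    (X : R -> R -> 'cV[R]_n -> 'cV[R]_n) (t0 : R) (x0 : 'cV[R]_n) :
    R -> 'cV[R]_k :=
  fun t => H t *m X t t0 x0.

(* The intersection of Y(I, M), t0 \in I, with C^0([t0, +oo); R^k), i.e. the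
   outputs with initial time t0. Functions on [t0, +oo) are represented by
   functions on R whose values before t0 are irrelevant. *)
Definition outputs (R : realType) (n k : nat) (H : R -> 'M[R]_(k, n))
    (X : R -> R -> 'cV[R]_n -> 'cV[R]_n) (t0 : R) (M : set 'cV[R]_n) :
    set (R -> 'cV[R]_k) :=
  [set y | {within halfline t0, continuous y} /\
           exists2 x0, M x0 & forall t, t0 <= t -> y t = output H X t0 x0 t].

(* Causality of the family a, where a y is a function of time with domain
   dom y; B absorbs possible further variables. *)
Definition causal (R : realType) (k : nat) (t0 : R) (Y : set (R -> 'cV[R]_k))
    (dom : (R -> 'cV[R]_k) -> set R) (B : Type)
    (a : (R -> 'cV[R]_k) -> R -> B) : Prop :=
  forall (y1 y2 : R -> 'cV[R]_k) (t : R), Y y1 -> Y y2 ->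
    dom y1 t -> dom y2 t ->
    (forall s, t0 <= s -> s <= t -> y1 s = y2 s) -> a y1 t = a y2 t.

Definition CP (R : realType) (l : nat) (t0 : R) (Q : R -> set 'cV[R]_l) :
    Prop :=
  forall (tau : nat -> R) (t : R) (q : nat -> 'cV[R]_l),
    (forall i, t0 <= tau i) -> t0 <= t -> tau @ \oo --> t ->
    (forall i, Q (tau i) (q i)) ->
    exists (sigma : nat -> nat) (q' : 'cV[R]_l),
      [/\ forall i j, (i < j)%N -> (sigma i < sigma j)%N,
          Q t q' & (q \o sigma) @ \oo --> q'].

Definition Yball (R : realType) (n k : nat) (H : R -> 'M[R]_(k, n))
    (beta : R -> R -> R -> R) (t0 r t : R) : set 'cV[R]_k :=
  [set y | exists2 x : 'cV[R]_n, enorm x <= beta t t0 r & y = H t *m x].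

Definition hyp_A1 (R : realType) (n k l : nat)
    (F : R -> 'cV[R]_n -> 'cV[R]_k -> 'cV[R]_n) (H : R -> 'M[R]_(k, n))
    (beta : R -> R -> R -> R) (A : R -> 'cV[R]_l -> 'cV[R]_k -> 'M[R]_n)
    (r t0 xi : R) (Q : R -> set 'cV[R]_l) : Prop :=
  CP t0 Q /\
  forall (t : R) (y : 'cV[R]_k) (x z : 'cV[R]_n),
    t0 <= t -> Yball H beta t0 r t y ->
    enorm x <= beta t t0 r -> enorm (x - z) <= xi ->
    exists2 q, Q t q & F t x y - F t z y = A t q y *m (x - z).

Definition int_d (R : realType) (a : R) (d : R -> R) (t : R) : R :=
  \int[@lebesgue_measure R]_(s in `[a, t]) d s.

(* P y and d y are the matrix and the function assigned to the output y. *)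
Definition hyp_A2' (R : realType) (n k l : nat) (H : R -> 'M[R]_(k, n))
    (M : set 'cV[R]_n) (X : R -> R -> 'cV[R]_n -> 'cV[R]_n)
    (A : R -> 'cV[R]_l -> 'cV[R]_k -> 'M[R]_n) (L r eps t0 t0' : R)
    (Q : R -> set 'cV[R]_l) (P : (R -> 'cV[R]_k) -> R -> 'M[R]_n)
    (d : (R -> 'cV[R]_k) -> R -> R) : Prop :=
  [/\ forall y, outputs H X t0 M y ->
        exists P' : R -> 'M[R]_n,
        [/\ C1_on (halfline t0') (P y) P' /\
              (forall t, t0' <= t -> (P y t)^T = P y t),
            {within halfline t0', continuous (d y)},
            (forall t, t0' <= t -> mx_ge (P y t) 1%:M) /\
              opnorm (P y t0') <= L,
            (forall t, t0' <= t -> - eps < int_d t0' (d y) t) /\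
              int_d t0' (d y) t @[t --> +oo] --> +oo &
            outputs H X t0 (eball r `&` M) y ->
            forall (t : R) (e : 'cV[R]_n) (q : 'cV[R]_l),
              t0' <= t -> H t *m e = 0 -> Q t q ->
              qform (P y t *m A t q (y t)) e + 2^-1 * qform (P' t) e
                <= - d y t * qform (P y t) e],
      {within [set p : R * 'cV[R]_n | t0' <= p.1 /\ M p.2],
         continuous (fun p => P (output H X t0 p.2) p.1)},
      {within [set p : R * 'cV[R]_n | t0' <= p.1 /\ M p.2],
         continuous (fun p => d (output H X t0 p.2) p.1)},
      causal t0 (outputs H X t0 M) (fun=> halfline t0') P &
      causal t0 (outputs H X t0 M) (fun=> halfline t0') d].

(* The requirements on the data assigned to a single output y: switching times
   T 1 < T 2 < ..., mappings g 1, g 2, ... and the set Mbar. The interval of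
   g 1 starts at the initial time t0 = t_1, whence T 0 = T 1 = t0. *)
Definition switching_observer (R : realType) (n k : nat)
    (H : R -> 'M[R]_(k, n)) (M : set 'cV[R]_n)
    (X : R -> R -> 'cV[R]_n -> 'cV[R]_n) (t0 : R) (y : R -> 'cV[R]_k)
    (T : nat -> R) (g : nat -> R -> 'cV[R]_n -> 'cV[R]_k -> 'cV[R]_n)
    (Mbar : set 'cV[R]_n) : Prop :=
  [/\ [/\ T 0%N = t0, T 1%N = t0, forall m, (0 < m)%N -> T m < T m.+1 &
          T @ \oo --> +oo],
      forall m, (0 < m)%N ->
        {within [set p : R * 'cV[R]_n * 'cV[R]_k |
                  T m.-1 <= p.1.1 /\ p.1.1 <= T m.+1],
           continuous (fun p => g m p.1.1 p.1.2 p.2)},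
      Mbar !=set0,
      forall m, (0 < m)%N -> forall (J : set R) (z : R -> 'cV[R]_n),
        maximal_solution (fun t z => g m t z (y t)) (T m.-1) (T m.+1) J z ->
        Mbar (z (T m.-1)) -> J = `[T m.-1, T m.+1]%classic &
      forall (z : nat -> R -> 'cV[R]_n) (Z : R -> 'cV[R]_n),
        (forall m, (0 < m)%N ->
          solves (fun t z => g m t z (y t)) `[T m.-1, T m.+1]%classic (z m) /\
          Mbar (z m (T m.-1))) ->
        (forall m t, (0 < m)%N -> T m <= t -> t < T m.+1 -> Z t = z m t) ->
        forall x0, M x0 ->
          (forall t, t0 <= t -> y t = output H X t0 x0 t) ->
          X t t0 x0 - Z t @[t --> +oo] --> (0 : 'cV[R]_n)].

Definition S_SODP (R : realType) (n k : nat) (H : R -> 'M[R]_(k, n))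
    (M : set 'cV[R]_n) (X : R -> R -> 'cV[R]_n -> 'cV[R]_n) : Prop :=
  forall t0 : R, 0 <= t0 ->
  exists (T : (R -> 'cV[R]_k) -> nat -> R)
    (g : (R -> 'cV[R]_k) -> nat -> R -> 'cV[R]_n -> 'cV[R]_k -> 'cV[R]_n)
    (Mbar : (R -> 'cV[R]_k) -> set 'cV[R]_n),
    (forall y, outputs H X t0 M y ->
      switching_observer H M X t0 y (T y) (g y) (Mbar y)) /\
    forall m, (0 < m)%N ->
      causal t0 (outputs H X t0 M) (fun y => `[T y m.-1, T y m.+1]%classic)
        (fun y => g y m).

(* Main.v *)
(* Fix the true initial state x0 and let x1 be any other initial state whose
   output agrees with y on [t0, s].  The error e between the two trajectories
   lies in ker H there and solves e' = A e, so V = e'Pe satisfies V' <= -2dV and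
   |e(s)|^2 <= L |e(t0)|^2 exp(-2 int d), uniformly over all such x1 of bounded
   norm.  Hence every initial state consistent with the past output gives an
   asymptotically correct estimate of the present state.  The observer selects,
   causally, a consistent initial state of almost minimal norm at time t_(m-1),
   and z_m runs from 0 to the corresponding value v_m before time t_m.  The
   switching times do not depend on y: their steps are so short that, for large
   t, no trajectory moves appreciably over two consecutive steps. *)

Require Import Defs.
From HB Require Import structures.
From mathcomp Require Import all_boot all_order all_algebra.
From mathcomp Require Import all_classical all_reals all_analysis.
From mathcomp Require Import ring lra.

Set Implicit Arguments.
Unset Strict Implicit.
Unset Printing Implicit Defensive.

Import Order.TTheory GRing.Theory Num.Theory.
Import numFieldNormedType.Exports.

Local Open Scope classical_set_scope.
Local Open Scope ring_scope.

(** * Derivatives relative to a set and the mean value inequality *)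

(** Clearing the denominator turns the punctured limit into an inequality on all of [J], since it is
    trivial at [s = t]. *)
Lemma deriv_withinP (R : realType) (V : normedModType R) (J : set R)
    (f : R -> V) (t : R) (v : V) :
  deriv_within J f t v <->
  forall e, 0 < e -> exists2 d, 0 < d &
    forall s, J s -> `|s - t| < d ->
      `|f s - f t - (s - t) *: v| <= e * `|s - t|.
Proof.
have quot s : s != t ->
    `|f s - f t - (s - t) *: v|
      = `|v - (s - t)^-1 *: (f s - f t)| * `|s - t|.
  move=> st; rewrite distrC mulrC -normrZ scalerBr scalerA divff ?subr_eq0//.
  by rewrite scale1r.
rewrite /deriv_within; split.
- move/cvgrPdist_le => + e e0 => /(_ e e0); rewrite near_withinE.
  move=> /nbhs_ballP[d /= d0 dP]; exists d => // s Js std.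
  have [->|st] := eqVneq s t; first by rewrite !subrr scale0r subr0 !normr0 mulr0.
  rewrite quot// ler_wpM2r//; apply: dP => //.
  by rewrite /ball/= distrC.
- move=> h; apply/cvgrPdist_le => e e0; rewrite near_withinE.
  have [d d0 dP] := h e e0.
  apply/nbhs_ballP; exists d => //= s; rewrite /ball/= distrC => std st Js.
  by have := dP _ Js std; rewrite quot// ler_pM2r// normr_gt0 subr_eq0.
Qed.

Lemma mx_coord_le (R : realType) (m n : nat) (x : 'M[R]_(m, n)) i j :
  `|x i j| <= `|x|.
Proof.
rewrite [leRHS]/Num.norm/= mx_normrE.
by apply/bigmax_geP; right => /=; exists (i, j).
Qed.

Lemma mx_norm_le (R : realType) (m n : nat) (x : 'M[R]_(m, n)) (c : R) :
  0 <= c -> (forall i j, `|x i j| <= c) -> `|x| <= c.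
Proof.
by move=> c0 h; rewrite [leLHS]/Num.norm/= mx_normrE; apply/bigmax_leP; split.
Qed.

Lemma deriv_within_coord (R : realType) (m n : nat) (J : set R)
    (f : R -> 'M[R]_(m, n)) (t : R) (v : 'M[R]_(m, n)) i j :
  deriv_within J f t v ->
  deriv_within J (fun s => f s i j : R) t (v i j).
Proof.
move=> /deriv_withinP h; apply/deriv_withinP => e /h[d d0 dP].
exists d => // s Js /(dP s Js); apply: le_trans.
by have := mx_coord_le (f s - f t - (s - t) *: v) i j; rewrite !mxE.
Qed.

Lemma deriv_within_cvg (R : realType) (V : normedModType R) (J : set R)
    (f : R -> V) (t : R) (v : V) :
  deriv_within J f t v -> f @ within J (nbhs t) --> f t.
Proof.
move=> /deriv_withinP h; apply/cvgrPdist_le => e e0; rewrite near_withinE.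
have [d d0 dP] := h 1 ltr01.
have c0 : 0 < 1 + `|v| by rewrite ltr_pwDl.
apply/nbhs_ballP; exists (Num.min d (e / (1 + `|v|))) => /=.
  by rewrite lt_min d0 divr_gt0.
move=> s; rewrite /ball/= distrC lt_min => /andP[sd se] Js.
have := dP _ Js sd; rewrite mul1r => h1.
rewrite distrC -(subrK ((s - t) *: v) (f s - f t)).
apply: (le_trans (ler_normD _ _)); rewrite normrZ.
apply: (le_trans (lerD h1 (lexx _))).
rewrite -[X in X + _]mulr1 -mulrDr -ler_pdivlMr//; exact: ltW.
Qed.

Lemma deriv_within_continuous (R : realType) (V : normedModType R) (J : set R)
    (f f' : R -> V) :
  (forall t, J t -> deriv_within J f t (f' t)) -> {within J, continuous f}.
Proof.
by move=> h; apply/subspace_continuousP => t /h; exact: deriv_within_cvg.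
Qed.

Lemma deriv_withinM (R : realType) (J : set R) (f g : R -> R) (t a b : R) :
  deriv_within J f t a -> deriv_within J g t b ->
  deriv_within J (fun s => f s * g s) t (a * g t + f t * b).
Proof.
move=> fa gb; rewrite /deriv_within.
have -> : (fun s => (s - t)^-1 *: (f s * g s - f t * g t)) =
    (fun s => (s - t)^-1 *: (f s - f t) * g s
              + f t * ((s - t)^-1 *: (g s - g t))).
  by apply/funext => s; rewrite /GRing.scale/=; ring.
apply: cvgD; apply: cvgM => //; last exact: cvg_cst.
apply: cvg_trans (deriv_within_cvg gb).
apply: cvg_app => A; rewrite /within/=; exact: nbhs_dnbhs.
Qed.

Lemma deriv_withinB (R : realType) (V : normedModType R) (J : set R)
    (f g : R -> V) (t : R) (a b : V) :
  deriv_within J f t a -> deriv_within J g t b ->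
  deriv_within J (fun s => f s - g s) t (a - b).
Proof.
move=> fa gb; rewrite /deriv_within.
have -> : (fun s => (s - t)^-1 *: (f s - g s - (f t - g t))) =
    (fun s => (s - t)^-1 *: (f s - f t) - (s - t)^-1 *: (g s - g t)).
  apply/funext => s; rewrite -scalerBr; congr (_ *: _).
  by rewrite !opprB addrACA [RHS]addrACA; congr (_ + _); rewrite addrC.
exact: cvgB.
Qed.

Lemma deriv_withinZl (R : realType) (V : normedModType R) (J : set R)
    (f : R -> R) (v : V) (t a : R) :
  deriv_within J f t a -> deriv_within J (fun s => f s *: v) t (a *: v).
Proof.
move=> fa; rewrite /deriv_within.
have -> : (fun s => (s - t)^-1 *: (f s *: v - f t *: v)) =
    (fun s => ((s - t)^-1 *: (f s - f t)) *: v).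
  by apply/funext => s; rewrite -scalerBl scalerA.
by apply: cvgZ => //; exact: cvg_cst.
Qed.

Lemma deriv_within_sum (R : realType) (J : set R) (I : finType)
    (f : I -> R -> R) (t : R) (v : I -> R) :
  (forall i, deriv_within J (f i) t (v i)) ->
  deriv_within J (fun s => \sum_i f i s) t (\sum_i v i).
Proof.
move=> h; rewrite /deriv_within.
have -> : (fun s => (s - t)^-1 *: (\sum_i f i s - \sum_i f i t)) =
    (fun s => \sum_i (s - t)^-1 *: (f i s - f i t)).
  by apply/funext => s; rewrite -sumrB scaler_sumr.
by apply: cvg_big => [|i _]; [exact: add_continuous|exact: h].
Qed.

(** At a point interior to [J] the restriction to [J] disappears: the difference quotient, completed
    by [v] at [t], is a Caratheodory slope continuous at [t]. *)
Lemma is_derive_within (R : realType) (J : set R) (f : R -> R) (a b t v : R) :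
  `]a, b[%classic `<=` J -> a < t -> t < b -> deriv_within J f t v ->
  is_derive t 1 f v.
Proof.
move=> abJ at_ tb /deriv_withinP h; apply/is_derive1_caratheodory.
exists (fun z => if z == t then v else (z - t)^-1 * (f z - f t)); split.
- move=> z; case: eqVneq => [->|zt]; first by rewrite !subrr mulr0.
  by rewrite mulrC mulrA divff ?mul1r ?subr_eq0.
- rewrite /prop_for /continuous_at /= eqxx; apply/cvgrPdist_le => e e0.
  have [d d0 dP] := h e e0.
  apply/nbhs_ballP; exists (Num.min d (Num.min (t - a) (b - t))) => /=.
    by rewrite !lt_min d0 !subr_gt0 at_ tb.
  move=> s; rewrite /ball/= distrC !lt_min => /and3P[sd sa sb].
  case: eqVneq => [_|st]; first by rewrite subrr normr0 ltW.
  have Js : J s.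
    apply: abJ; rewrite /= in_itv/=; move: sa sb; rewrite !ltr_norml; lra.
  have st0 : 0 < `|s - t| by rewrite normr_gt0 subr_eq0.
  rewrite -(ler_pM2r st0); apply: le_trans (dP _ Js sd).
  rewrite -normrM mulrBl mulrAC mulVf ?subr_eq0// mul1r distrC.
  by rewrite [(s - t) *: v]mulrC.
- by rewrite eqxx.
Qed.

Lemma deriv_within_is_derive (R : realType) (J : set R) (f : R -> R) (t v : R) :
  is_derive t 1 f v -> deriv_within J f t v.
Proof.
move=> /is_derive1_caratheodory[g [fg gc gt]]; apply/deriv_withinP => e e0.
move: gc; rewrite /continuous_at => /cvgrPdist_le/(_ e e0)/nbhs_ballP[d /= d0 dP].
exists d => // s Js sd; rewrite fg [_ *: _]mulrC -mulrBl normrM ler_wpM2r//.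
rewrite -gt distrC; apply: dP; by rewrite /ball/= distrC.
Qed.

Lemma deriv_within_sub (R : realType) (V : normedModType R) (J K : set R)
    (f : R -> V) (t : R) (v : V) :
  K `<=` J -> deriv_within J f t v -> deriv_within K f t v.
Proof.
move=> KJ /deriv_withinP h; apply/deriv_withinP => e /h[d d0 dP].
by exists d => // s /KJ; exact: dP.
Qed.

Lemma nincr_of_is_derive (R : realType) (f f' : R -> R) (a b : R) :
  a <= b -> {within `[a, b], continuous f} ->
  (forall t, a < t -> t < b -> is_derive t 1 f (f' t)) ->
  (forall t, a < t -> t < b -> f' t <= 0) -> f b <= f a.
Proof.
move=> ab fc fd fle.
apply: (@ler0_derive1_le_cc _ f a b) => //.
- move=> x; rewrite in_itv/= => /andP[ax xb].
  by have [] := fd _ ax xb.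
- move=> x; rewrite in_itv/= => /andP[ax xb].
  have fdx := fd _ ax xb.
  by rewrite derive1E derive_val; exact: fle.
- by rewrite in_itv/= lexx ab.
- by rewrite in_itv/= lexx ab.
Qed.

(** The norm is the largest absolute entry, so it suffices to treat each entry [g]: [g - c t] is
    nonincreasing, and the same argument for [- g] gives the lower bound. *)
Lemma deriv_within_lipschitz (R : realType) (m n : nat) (a b c : R)
    (f f' : R -> 'M[R]_(m, n)) :
  a <= b -> 0 <= c ->
  (forall t, a <= t -> t <= b -> deriv_within `[a, b] f t (f' t)) ->
  (forall t, a <= t -> t <= b -> `|f' t| <= c) ->
  `|f b - f a| <= c * (b - a).
Proof.
move=> ab c0 df fc.
have side (g g' : R -> R) :
    (forall t, a <= t -> t <= b -> deriv_within `[a, b] g t (g' t)) ->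
    (forall t, a <= t -> t <= b -> g' t <= c) -> g b - g a <= c * (b - a).
  move=> dg gc.
  have dh t : a <= t -> t <= b ->
      deriv_within `[a, b] (fun s => g s - c * s) t (g' t - c).
    move=> at_ tb; apply: deriv_withinB; first exact: dg.
    apply: deriv_within_is_derive.
    apply: (is_derive_eq (is_deriveZ c (is_derive_id t 1))).
    by rewrite /GRing.scale/= mulr1.
  have : g b - c * b <= g a - c * a.
    apply: (@nincr_of_is_derive _ (fun s => g s - c * s) (fun t => g' t - c)) => //.
    - apply: (@deriv_within_continuous _ _ _ _ (fun t => g' t - c)) => t.
      by rewrite /= in_itv/= => /andP[]; exact: dh.
    - move=> t at_ tb; apply: (@is_derive_within _ `[a, b] _ a b) => //.
        exact: subset_itv_oo_cc.
      by apply: dh; exact: ltW.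
    - by move=> t at_ tb; rewrite subr_le0; apply: gc; exact: ltW.
  lra.
apply: mx_norm_le => [|i j]; first by rewrite mulr_ge0// subr_ge0.
rewrite !mxE ler_norml; apply/andP; split.
  rewrite lerNl opprB.
  have := side (fun t => 0 - f t i j) (fun t => 0 - f' t i j).
  rewrite !sub0r opprK addrC; apply.
    move=> t at_ tb; apply: deriv_withinB.
      by apply: deriv_within_is_derive; exact: is_derive_cst.
    by apply: deriv_within_coord; exact: df.
  move=> t at_ tb; rewrite sub0r lerNl.
  by have := le_trans (mx_coord_le _ i j) (fc _ at_ tb); rewrite ler_norml => /andP[].
apply: (side (fun t => f t i j) (fun t => f' t i j)).
  by move=> t at_ tb; apply: deriv_within_coord; exact: df.
move=> t at_ tb.
by have := le_trans (mx_coord_le _ i j) (fc _ at_ tb); rewrite ler_norml => /andP[].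
Qed.

(** * Euclidean norm, operator norm and quadratic forms *)

Lemma sum_sqr_ge0 (R : realType) (n : nat) (x : 'cV[R]_n) :
  0 <= \sum_(i < n) x i ord0 ^+ 2.
Proof. by apply: sumr_ge0 => i _; exact: sqr_ge0. Qed.

Lemma enorm_ge0 (R : realType) (n : nat) (x : 'cV[R]_n) : 0 <= enorm x.
Proof. exact: sqrtr_ge0. Qed.

Lemma enorm_sqr (R : realType) (n : nat) (x : 'cV[R]_n) :
  enorm x ^+ 2 = \sum_(i < n) x i ord0 ^+ 2.
Proof. by rewrite sqr_sqrtr// sum_sqr_ge0. Qed.

Lemma enorm0 (R : realType) (n : nat) : enorm (0 : 'cV[R]_n) = 0.
Proof.
by rewrite /enorm big1 ?sqrtr0// => i _; rewrite mxE expr0n.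
Qed.

(** [|x|] is the maximum norm, in which limits and compactness are expressed; Euclidean bounds pass
    to it with the same constant. *)
Lemma norm_le_enorm (R : realType) (n : nat) (x : 'cV[R]_n) : `|x| <= enorm x.
Proof.
apply: mx_norm_le (enorm_ge0 x) _ => i j; rewrite (ord1 j).
rewrite -[leLHS]ger0_norm// -ler_sqr ?nnegrE ?enorm_ge0// ?normr_ge0//.
rewrite normr_id real_normK ?num_real// enorm_sqr (bigD1 i)//= lerDl.
by apply: sumr_ge0 => k _; exact: sqr_ge0.
Qed.

Lemma enormZ (R : realType) (n : nat) (a : R) (x : 'cV[R]_n) :
  enorm (a *: x) = `|a| * enorm x.
Proof.
rewrite -sqrtr_sqr /enorm -sqrtrM ?sqr_ge0// mulr_sumr.
by congr Num.sqrt; apply: eq_bigr => i _; rewrite mxE exprMn.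
Qed.

(** Coordinatewise [(p - q)^2 <= 2 p^2 + 2 q^2] suffices for two vectors under the same bound. *)
Lemma enormB_le (R : realType) (n : nat) (b : R) (x y : 'cV[R]_n) :
  enorm x <= b -> enorm y <= b -> enorm (x - y) <= 2 * b.
Proof.
move=> xb yb; have b0 := le_trans (enorm_ge0 x) xb.
rewrite -ler_sqr ?nnegrE ?enorm_ge0//; last by rewrite mulr_ge0.
apply: (@le_trans _ _ (2 * enorm x ^+ 2 + 2 * enorm y ^+ 2)).
  rewrite !enorm_sqr !mulr_sumr -big_split/=; apply: ler_sum => i _.
  rewrite !mxE -subr_ge0.
  set p := x i _; set q := y i _.
  have -> : 2 * p ^+ 2 + 2 * q ^+ 2 - (p - q) ^+ 2 = (p + q) ^+ 2 by ring.
  exact: sqr_ge0.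
have := enorm_ge0 x; have := enorm_ge0 y; nra.
Qed.

(** The bilinear form [x' B y], written as a double sum so that the product rule can be applied term
    by term. *)
Definition bform (R : realType) (n : nat) (B : 'M[R]_n) (x y : 'cV[R]_n) : R :=
  \sum_(i < n) \sum_(j < n) x i ord0 * B i j * y j ord0.

Lemma bformE (R : realType) (n : nat) (B : 'M[R]_n) (x y : 'cV[R]_n) :
  bform B x y = (x^T *m B *m y) ord0 ord0.
Proof.
rewrite !mxE /bform exchange_big/=; apply: eq_bigr => j _.
rewrite !mxE mulr_suml; apply: eq_bigr => i _.
by rewrite !mxE.
Qed.

Lemma bformC (R : realType) (n : nat) (B : 'M[R]_n) (x y : 'cV[R]_n) :
  B^T = B -> bform B x y = bform B y x.
Proof.
move=> BT; rewrite /bform exchange_big/=; apply: eq_bigr => i _.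
apply: eq_bigr => j _; rewrite -[in LHS]BT mxE; ring.
Qed.

Lemma qform1 (R : realType) (n : nat) (x : 'cV[R]_n) :
  qform 1%:M x = enorm x ^+ 2.
Proof.
by rewrite /qform mulmx1 enorm_sqr !mxE; apply: eq_bigr => i _; rewrite !mxE.
Qed.

(** A unit vector has entries of absolute value at most 1, so the absolute row sums of [B] bound its
    image. Hence [opnorm] is the supremum of a bounded set. *)
Lemma enorm_mulmx_bound (R : realType) (n : nat) (B : 'M[R]_n) :
  exists c : R, forall v : 'cV[R]_n, enorm v = 1 -> enorm (B *m v) <= c.
Proof.
pose c := \sum_(i < n) (\sum_(j < n) `|B i j|) ^+ 2.
have c0 : 0 <= c by apply: sumr_ge0 => i _; exact: sqr_ge0.
exists (Num.sqrt c) => v v1; rewrite /enorm ler_sqrt//.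
apply: ler_sum => i _; rewrite -[leLHS]real_normK ?num_real//.
have s0 : 0 <= \sum_(j < n) `|B i j| by apply: sumr_ge0.
rewrite ler_sqr ?nnegrE// mxE.
apply: (le_trans (ler_norm_sum _ _ _)); apply: ler_sum => j _.
rewrite normrM ler_piMr//.
apply: le_trans (mx_coord_le _ _ _) _.
by rewrite -v1; exact: norm_le_enorm.
Qed.

Lemma enorm_mulmx_le (R : realType) (n : nat) (B : 'M[R]_n) (e : 'cV[R]_n) :
  enorm (B *m e) <= opnorm B * enorm e.
Proof.
have [e0|e0] := eqVneq (enorm e) 0.
  have -> : e = 0.
    apply/eqP; rewrite -normr_le0; apply: le_trans (norm_le_enorm e) _.
    by rewrite e0.
  by rewrite mulmx0 enorm0 mulr0.
have epos : 0 < enorm e by rewrite lt_neqAle eq_sym e0 enorm_ge0.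
rewrite -ler_pdivrMr//.
apply: sup_ubound.
  have [c cP] := enorm_mulmx_bound B.
  by exists c => _ [v /= v1 <-]; exact: cP.
exists ((enorm e)^-1 *: e) => /=.
  by rewrite enormZ gtr0_norm ?invr_gt0// mulVf.
by rewrite -scalemxAr enormZ gtr0_norm ?invr_gt0// mulrC.
Qed.

(** Summing [(L e_i - (B e)_i)^2 >= 0] gives [2 L e'Be <= L^2 |e|^2 + |Be|^2 <= 2 L^2 |e|^2], and
    [L] cancels. *)
Lemma qform_le_opnorm (R : realType) (n : nat) (B : 'M[R]_n) (L : R)
    (e : 'cV[R]_n) :
  0 < L -> opnorm B <= L -> qform B e <= L * enorm e ^+ 2.
Proof.
move=> L0 BL.
have BeL : enorm (B *m e) <= L * enorm e.
  apply: le_trans (enorm_mulmx_le B e) _.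
  by rewrite ler_wpM2r// enorm_ge0.
have BeL2 : enorm (B *m e) ^+ 2 <= L ^+ 2 * enorm e ^+ 2.
  by rewrite -exprMn ler_sqr ?nnegrE ?mulr_ge0 ?enorm_ge0// ltW.
have : L * qform B e * 2 <= L ^+ 2 * enorm e ^+ 2 + enorm (B *m e) ^+ 2.
  rewrite /qform -mulmxA !enorm_sqr mxE mulr_sumr mulr_suml mulr_sumr.
  rewrite -big_split/=; apply: ler_sum => i _.
  rewrite mxE; set p := e i _; set q := (B *m e) i _; rewrite -subr_ge0.
  have -> : L ^+ 2 * p ^+ 2 + q ^+ 2 - L * (p * q) * 2 = (L * p - q) ^+ 2.
    by ring.
  exact: sqr_ge0.
move=> h; rewrite -(ler_pM2l L0).
have : L * qform B e * 2 <= L * (L * enorm e ^+ 2) * 2 by lra.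
lra.
Qed.

Lemma deriv_within_qform (R : realType) (n : nat) (J : set R)
    (P : R -> 'M[R]_n) (P' : 'M[R]_n) (e : R -> 'cV[R]_n) (e' : 'cV[R]_n)
    (t : R) :
  (P t)^T = P t -> deriv_within J P t P' -> deriv_within J e t e' ->
  deriv_within J (fun s => qform (P s) (e s)) t
    (2 * bform (P t) (e t) e' + qform P' (e t)).
Proof.
move=> PT dP de.
have -> : (fun s => qform (P s) (e s)) = (fun s => bform (P s) (e s) (e s)).
  by apply/funext => s; rewrite bformE.
have -> : 2 * bform (P t) (e t) e' + qform P' (e t) =
   \sum_(i < n) \sum_(j < n) ((e' i ord0 * P t i j + e t i ord0 * P' i j)
     * e t j ord0 + e t i ord0 * P t i j * e' j ord0).
  rewrite mulrDl mul1r {1}(bformC _ _ PT) /qform -bformE /bform -!big_split/=.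
  apply: eq_bigr => i _; rewrite -!big_split/=; apply: eq_bigr => j _; ring.
apply: deriv_within_sum => i; apply: deriv_within_sum => j.
apply: deriv_withinM; last exact: deriv_within_coord.
by apply: deriv_withinM; exact: deriv_within_coord.
Qed.

(** * Decay of a Lyapunov function *)

Lemma int_d_is_derive (R : realType) (a t : R) (d : R -> R) :
  {within halfline a, continuous d} -> a < t -> is_derive t 1 (int_d a d) (d t).
Proof.
move=> dc at_.
have dcW : {within `[a, t + 1], continuous d}.
  apply: continuous_subspaceW dc => s; rewrite /= in_itv/=.
  by move=> /andP[].
have t1 : t < t + 1 by rewrite ltrDl.
have intd := continuous_compact_integrable (@segment_compact _ a (t + 1)) dcW.
have dct : {for t, continuous d}.
  apply: (within_continuous_continuous _ dcW); first exact: lt_trans t1.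
  by rewrite in_itv/= at_ t1.
have [h1 h2] := continuous_FTC1_closed t1 intd at_ dct.
by apply: DeriveDef; [exact: h1 | rewrite -derive1E; exact: h2].
Qed.

Lemma int_d_continuous (R : realType) (a b : R) (d : R -> R) :
  {within halfline a, continuous d} -> a <= b ->
  {within `[a, b], continuous (int_d a d)}.
Proof.
move=> dc ab; apply: parameterized_integral_continuous => //.
apply: continuous_compact_integrable; first exact: segment_compact.
by apply: continuous_subspaceW dc => s; rewrite /= in_itv/= => /andP[].
Qed.

Lemma int_d0 (R : realType) (a : R) (d : R -> R) : int_d a d a = 0.
Proof. by rewrite /int_d set_itv1 Rintegral_set1. Qed.

(** Integrating factor: [W = V exp(2 int d)] has nonpositive derivative, and the integral vanishes
    at [a]. *)
Lemma decay_of_deriv_le (R : realType) (a b : R) (V V' d : R -> R) :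
  a <= b -> {within halfline a, continuous d} ->
  (forall t, a <= t -> t <= b -> deriv_within `[a, b] V t (V' t)) ->
  (forall t, a <= t -> t <= b -> V' t <= - (2 * d t) * V t) ->
  V b <= V a * expR (- (2 * int_d a d b)).
Proof.
move=> ab dc dV Vle.
pose W t := V t * expR (2 * int_d a d t).
pose W' t := V' t * expR (2 * int_d a d t)
             + V t * (2 * d t * expR (2 * int_d a d t)).
have Vc : {within `[a, b], continuous V}.
  apply: (@deriv_within_continuous _ _ _ V V') => t /=; rewrite in_itv/=.
  by move=> /andP[]; exact: dV.
suff : W b <= W a.
  rewrite /W int_d0 mulr0 expR0 mulr1 => h.
  by rewrite expRN ler_pdivlMr ?expR_gt0.
apply: (@nincr_of_is_derive _ W W') => //.
- apply/subspace_continuousP => t abt; rewrite /W.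
  have /subspace_continuousP/(_ _ abt) Vt := Vc.
  have /subspace_continuousP/(_ _ abt) It := int_d_continuous dc ab.
  apply: cvgM => //.
  apply: (@cvg_comp _ _ _ (fun s => 2 * int_d a d s) expR); last first.
    exact: continuous_expR.
  by apply: cvgM => //; exact: cvg_cst.
- move=> t at_ tb.
  have dVt : is_derive t 1 V (V' t).
    apply: (@is_derive_within _ `[a, b] _ a b) => //; last exact: dV (ltW _) (ltW _).
    exact: subset_itv_oo_cc.
  have dI := int_d_is_derive dc at_.
  have dE : is_derive t 1 (fun s => expR (2 * int_d a d s))
     (2 * d t * expR (2 * int_d a d t)).
    have h : is_derive t 1 (fun s => 2 * int_d a d s) (2 * d t).
      have := is_deriveZ 2 dI; exact.
    have hc := @is_derive1_comp _ expR (fun s => 2 * int_d a d s) t _ _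
      (is_derive_expR _) h.
    by apply: (is_derive_eq hc); rewrite mulrC.
  have := is_deriveM dVt dE.
  move=> /is_derive_eq; apply; rewrite /W' /GRing.scale/= addrC; congr (_ + _).
  by rewrite mulrC.
- move=> t at_ tb; rewrite /W'.
  have -> : V' t * expR (2 * int_d a d t)
             + V t * (2 * d t * expR (2 * int_d a d t)) =
     (V' t + 2 * d t * V t) * expR (2 * int_d a d t) by ring.
  rewrite pmulr_lle0 ?expR_gt0//.
  by have := Vle _ (ltW at_) (ltW tb); rewrite mulNr; lra.
Qed.

(** * Error estimate and detectability *)

(** Both trajectories produce [y] on [[t0, s]], so there they solve the same equation with [y]
    inserted. The factor [L] comes from [|P(t0)| <= L], [(2 r)^2] from the initial states, and
    [P >= I] bounds [|e(s)|^2] by [V(s)]. The bound [xi] on the error is still assumed here. *)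
Lemma error_decay (R : realType) (n k l : nat)
    (F : R -> 'cV[R]_n -> 'cV[R]_k -> 'cV[R]_n) (H : R -> 'M[R]_(k, n))
    (M : set 'cV[R]_n) (X : R -> R -> 'cV[R]_n -> 'cV[R]_n)
    (beta : R -> R -> R -> R) (A : R -> 'cV[R]_l -> 'cV[R]_k -> 'M[R]_n)
    (L r eps t0 xi s : R) (Q : R -> set 'cV[R]_l)
    (P : (R -> 'cV[R]_k) -> R -> 'M[R]_n) (d : (R -> 'cV[R]_k) -> R -> R)
    (y : R -> 'cV[R]_k) (x0 x1 : 'cV[R]_n) :
  is_flow F H M X -> forward_complete M X beta ->
  0 <= t0 -> 0 < L -> hyp_A1 F H beta A r t0 xi Q ->
  hyp_A2' H M X A L r eps t0 t0 Q P d ->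
  outputs H X t0 M y -> M x0 -> enorm x0 <= r ->
  (forall t, t0 <= t -> y t = output H X t0 x0 t) ->
  M x1 -> enorm x1 <= r -> t0 <= s ->
  (forall t, t0 <= t -> t <= s -> y t = output H X t0 x1 t) ->
  (forall t, t0 <= t -> t <= s -> enorm (X t t0 x1 - X t t0 x0) <= xi) ->
  enorm (X s t0 x1 - X s t0 x0) ^+ 2
    <= L * (2 * r) ^+ 2 * expR (- (2 * int_d t0 (d y) s)).
Proof.
move=> flow [[_ _ _ betaN] fc] t00 L0 [_ hA1] [hA2 _ _ _ _] yO Mx0 x0r yx0 Mx1 x1r
  t0s yx1 exi.
have [P' [[[dP _] PT] dc [PI PL] _ hlyap]] := hA2 y yO.
(* The Lyapunov inequality is available only for outputs from initial states in the ball of radius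
   [r]; [x0] is one. *)
have yO' : outputs H X t0 (eball r `&` M) y.
  by case: yO => yc _; split => //; exists x0.
have {}hlyap := hlyap yO'.
have [X00 dX0] := flow _ _ t00 Mx0.
have [X10 dX1] := flow _ _ t00 Mx1.
pose e t := X t t0 x1 - X t t0 x0.
pose e' t := F t (X t t0 x1) (y t) - F t (X t t0 x0) (y t).
have de t : t0 <= t -> t <= s -> deriv_within `[t0, s] e t (e' t).
  move=> t0t ts.
  have J : `[t0, s]%classic `<=` halfline t0.
    by move=> u; rewrite /= in_itv/= => /andP[].
  have h1 := deriv_within_sub J (dX1 _ t0t).
  have h0 := deriv_within_sub J (dX0 _ t0t).
  by rewrite /e' {1}yx1// yx0//; exact: deriv_withinB.
have betar x t : t0 <= t -> M x -> enorm x <= r ->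
    enorm (X t t0 x) <= beta t t0 r.
  move=> t0t Mx xr; apply: le_trans (fc _ _ _ t00 t0t Mx) _.
  have [_ _ mono] := betaN t t0 (le_trans t00 t0t) t00.
  by apply: mono => //; exact: enorm_ge0.
have V0 : qform (P y t0) (e t0) <= L * (2 * r) ^+ 2.
  apply: le_trans (qform_le_opnorm _ L0 PL) _.
  have h : enorm (e t0) <= 2 * r by rewrite /e X00 X10; exact: enormB_le.
  rewrite ler_pM2l// ler_sqr ?nnegrE ?enorm_ge0//.
  exact: le_trans (enorm_ge0 _) h.
have Vs : enorm (e s) ^+ 2 <= qform (P y s) (e s).
  by rewrite -qform1; exact: PI.
apply: le_trans Vs _.
apply: le_trans (_ : qform (P y t0) (e t0) * expR (- (2 * int_d t0 (d y) s)) <= _);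
  last by rewrite ler_pM2r ?expR_gt0.
apply: (@decay_of_deriv_le _ t0 s (fun t => qform (P y t) (e t))
  (fun t => 2 * bform (P y t) (e t) (e' t) + qform (P' t) (e t))) => //.
  move=> t t0t ts; apply: deriv_within_qform; [exact: PT| |exact: de].
  apply: deriv_within_sub (dP _ t0t) => u.
  by rewrite /= in_itv/= => /andP[].
move=> t t0t ts /=.
have Hx1 := yx1 _ t0t ts.
have [|q Qq hq] := hA1 t (y t) (X t t0 x1) (X t t0 x0) t0t _ (betar _ _ t0t Mx1 x1r)
  (exi _ t0t ts).
  by exists (X t t0 x1) => //; exact: betar.
have He : H t *m e t = 0.
  rewrite /e mulmxBr.
  have := yx0 _ t0t; rewrite /output => <-.
  by move: Hx1; rewrite /output => <-; rewrite subrr.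
have := hlyap t (e t) q t0t He Qq.
have -> : qform (P y t *m A t q (y t)) (e t) = bform (P y t) (e t) (e' t).
  by rewrite bformE /qform /e' hq !mulmxA.
lra.
Qed.

(** [error_decay] is applied twice. The first pass, with a bound depending on [s], shows that the
    error never exceeds a fixed [xi]. The second, with this [xi], has one function [d] for all [s]
    and [x1], so the divergence of its integral gives a uniform [tau]. *)
Lemma detectability (R : realType) (n k l : nat)
    (F : R -> 'cV[R]_n -> 'cV[R]_k -> 'cV[R]_n) (H : R -> 'M[R]_(k, n))
    (M : set 'cV[R]_n) (X : R -> R -> 'cV[R]_n -> 'cV[R]_n)
    (beta : R -> R -> R -> R) (A : R -> 'cV[R]_l -> 'cV[R]_k -> 'M[R]_n)
    (L r eps t0 : R) (Q : R -> R -> R -> set 'cV[R]_l)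
    (y : R -> 'cV[R]_k) (x0 : 'cV[R]_n) :
  is_flow F H M X -> forward_complete M X beta ->
  0 <= t0 -> 0 < L -> 0 < r ->
  (forall xi, 0 < xi -> hyp_A1 F H beta A r t0 xi (Q t0 xi)) ->
  (forall xi, 0 < xi ->
    exists (P : (R -> 'cV[R]_k) -> R -> 'M[R]_n)
      (d : (R -> 'cV[R]_k) -> R -> R),
      hyp_A2' H M X A L r eps t0 t0 (Q t0 xi) P d) ->
  outputs H X t0 M y -> M x0 -> enorm x0 <= r ->
  (forall t, t0 <= t -> y t = output H X t0 x0 t) ->
  forall eta : R, 0 < eta -> exists tau : R,
    forall (s : R) (x1 : 'cV[R]_n), tau <= s -> t0 <= s ->
    M x1 -> enorm x1 <= r ->
    (forall t, t0 <= t -> t <= s -> y t = output H X t0 x1 t) ->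
    enorm (X s t0 x1 - X s t0 x0) <= eta.
Proof.
move=> flow fc t00 L0 r0 hA1 hA2 yO Mx0 x0r yx0 eta eta0.
pose c := L * (2 * r) ^+ 2.
have c0 : 0 < c by rewrite mulr_gt0// exprn_gt0// mulr_gt0.
(* The bound on the error when [int d > - eps], enlarged by 1 to be visibly positive. *)
pose xi := Num.sqrt (c * expR (2 * eps)) + 1.
have xi0 : 0 < xi by rewrite ltr_wpDl// sqrtr_ge0.
(* eps does not depend on xi, so a bound xi_s valid up to time s only
   already yields the uniform bound xi. *)
have errxi s x1 : t0 <= s -> M x1 -> enorm x1 <= r ->
    (forall t, t0 <= t -> t <= s -> y t = output H X t0 x1 t) ->
    enorm (X s t0 x1 - X s t0 x0) <= xi.
  move=> t0s Mx1 x1r yx1.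
  have [[_ betaN1 _ betaN3] fcb] := fc.
  have [beta_ge0 _ _] := betaN1 t0 r t00 (ltW r0).
  (* On [[t0, s]] both trajectories are bounded by [beta s t0 r], so this is an a priori bound on
     their distance. *)
  have xis0 : 0 < 2 * beta s t0 r + 1.
    rewrite ltr_wpDl// mulr_ge0//; apply: beta_ge0; exact: le_trans t0s.
  have [P [d hP]] := hA2 _ xis0.
  have betas x t : t0 <= t -> t <= s -> M x -> enorm x <= r ->
      enorm (X t t0 x) <= beta s t0 r.
    move=> t0t ts Mx xr; apply: le_trans (fcb _ _ _ t00 t0t Mx) _.
    have [_ _ mono3] := betaN3 t t0 (le_trans t00 t0t) t00.
    have [_ _ mono1] := betaN1 t0 r t00 (ltW r0).
    apply: le_trans (mono3 _ _ (enorm_ge0 _) xr) _.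
    by apply: mono1 => //; exact: le_trans t0t.
  have := error_decay flow fc t00 L0 (hA1 _ xis0) hP yO Mx0 x0r yx0 Mx1 x1r t0s yx1.
  move=> h; have {h} : enorm (X s t0 x1 - X s t0 x0) ^+ 2
      <= c * expR (- (2 * int_d t0 (d y) s)).
    apply: h => t t0t ts.
    apply: le_trans (enormB_le (betas _ _ t0t ts Mx1 x1r) (betas _ _ t0t ts Mx0 x0r)) _.
    by rewrite lerDl.
  move=> h.
  rewrite -[leLHS]ger0_norm ?enorm_ge0// -sqrtr_sqr /xi ler_wpDr//.
  rewrite ler_wsqrtr//; apply: le_trans h _; rewrite ler_pM2l// ler_expR.
  have [hA2y _ _ _ _] := hP.
  have [_ [_ _ _ [/(_ s t0s) int_gt _] _]] := hA2y y yO.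
  lra.
have [P [d hP]] := hA2 _ xi0.
have [hA2y _ _ _ _] := hP.
have [_ [_ _ _ [_ int_y] _]] := hA2y y yO.
(* [m] solves [c exp(- 2 m) = eta^2]. *)
pose m := ln (c / eta ^+ 2) / 2.
have [tau [_ htau]] := (cvgryPge _).1 int_y m.
exists (tau + 1) => s x1 taus t0s Mx1 x1r yx1.
have h : enorm (X s t0 x1 - X s t0 x0) ^+ 2
      <= c * expR (- (2 * int_d t0 (d y) s)).
  apply: (error_decay flow fc t00 L0 (hA1 _ xi0) hP yO Mx0 x0r yx0 Mx1 x1r t0s yx1).
  move=> t t0t ts; apply: errxi => // u t0u ut; apply: yx1 => //.
  exact: le_trans ts.
rewrite -ler_sqr ?nnegrE ?enorm_ge0 ?(ltW eta0)//.
apply: le_trans h _.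
have ms : m <= int_d t0 (d y) s.
  by apply: htau; apply: lt_le_trans taus; rewrite ltrDl.
have eta20 : 0 < eta ^+ 2 by rewrite exprn_gt0.
apply: (@le_trans _ _ (c * expR (- ln (c / eta ^+ 2)))).
  by rewrite ler_pM2l// ler_expR; move: ms; rewrite /m; lra.
rewrite expRN lnK ?posrE ?divr_gt0// invf_div mulrCA divff ?mulr1//.
by rewrite gt_eqF.
Qed.

(** * Bounds on the vector field *)

Lemma compact_cV_ball (R : realType) (n : nat) (r : R) :
  compact [set x : 'cV[R]_n | `|x| <= r].
Proof.
have Kc : compact [set v : 'rV[R]_n | forall i, v ord0 i \in `[- r, r]].
  apply: (@rV_compact _ _ (fun=> `[- r, r]%classic)) => _.
  exact: segment_compact.
have [r0|r0] := ltP r 0.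
  suff -> : [set x : 'cV[R]_n | `|x| <= r] = set0 by exact: compact0.
  apply/seteqP; split => x //= xr; have := le_lt_trans xr r0.
  by rewrite ltNge normr_ge0.
suff -> : [set x : 'cV[R]_n | `|x| <= r] =
    trmx @` [set v : 'rV[R]_n | forall i, v ord0 i \in `[- r, r]].
  apply: continuous_compact => //; apply: continuous_subspaceT => u.
  apply/(@cvgrPdist_le _ _ _ _ (nbhs_filter u)) => e e0.
  apply/nbhs_ballP; exists e => //= w.
  rewrite -ball_normE/= => /ltW uw; rewrite -linearB/=.
  apply: mx_norm_le (ltW e0) _ => i j; rewrite mxE.
  exact: le_trans (mx_coord_le _ _ _) uw.
apply/seteqP; split => [x /= xr|_ [v /= vr <-]].
  exists x^T; last by rewrite trmxK.
  move=> i; rewrite mxE in_itv/= -ler_norml.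
  exact: le_trans (mx_coord_le _ _ _) xr.
apply: mx_norm_le r0 _ => i j; rewrite mxE (ord1 j).
by have := vr i; rewrite in_itv/= -ler_norml.
Qed.

Lemma norm_mulmx_le (R : realType) (m n p : nat) (A : 'M[R]_(m, n))
    (B : 'M[R]_(n, p)) : `|A *m B| <= n%:R * (`|A| * `|B|).
Proof.
apply: mx_norm_le => [|i j]; first by rewrite !mulr_ge0.
rewrite mxE; apply: (le_trans (ler_norm_sum _ _ _)).
apply: (@le_trans _ _ (\sum_(k < n) `|A| * `|B|)); last first.
  by rewrite sumr_const card_ord mulr_natl.
apply: ler_sum => k _; rewrite normrM.
by apply: ler_pM => //; exact: mx_coord_le.
Qed.

Lemma within_compact_bounded (R : realType) (T : topologicalType)
    (V : normedModType R) (f : T -> V) (K : set T) :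
  compact K -> {within K, continuous f} ->
  exists c : R, forall x, K x -> `|f x| <= c.
Proof.
move=> cK fK; have /compact_bounded[c [_ cP]] := continuous_compact fK cK.
by exists (c + 1) => x Kx; apply: (cP _ _ (f x)); [rewrite ltrDl|exists x].
Qed.

(** [H] is bounded on [[0, tau]], so the points [(t, x, H t x)] stay in a compact product on which
    [F] is continuous. *)
Lemma vector_field_bound (R : realType) (n k : nat)
    (F : R -> 'cV[R]_n -> 'cV[R]_k -> 'cV[R]_n) (H : R -> 'M[R]_(k, n))
    (tau rho : R) :
  {within halfline 0, continuous H} ->
  {within [set p : R * 'cV[R]_n * 'cV[R]_k | 0 <= p.1.1],
     continuous (fun p => F p.1.1 p.1.2 p.2)} ->
  exists c : R, forall (t : R) (x : 'cV[R]_n), 0 <= t -> t <= tau -> `|x| <= rho ->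
    `|F t x (H t *m x)| <= c.
Proof.
move=> Hc Fc.
have [h hP] : exists h, forall t, t \in `[0, tau] -> `|H t| <= h.
  apply: (@within_compact_bounded _ _ _ H `[0, tau]%classic).
    exact: segment_compact.
  by apply: continuous_subspaceW Hc => t; rewrite /= in_itv/= => /andP[].
pose rho' := n%:R * (h * rho).
pose K := `[0, tau]%classic `*` [set x : 'cV[R]_n | `|x| <= rho]
            `*` [set y : 'cV[R]_k | `|y| <= rho'].
have [c cP] : exists c, forall p, K p -> `|F p.1.1 p.1.2 p.2| <= c.
  apply: (@within_compact_bounded _ _ _ (fun p : R * 'cV[R]_n * 'cV[R]_k =>
     F p.1.1 p.1.2 p.2) K).
    apply: compact_setX; last exact: compact_cV_ball.
    by apply: compact_setX; [exact: segment_compact|exact: compact_cV_ball].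
  by apply: continuous_subspaceW Fc => p [[]] /=; rewrite in_itv/= => /andP[].
exists c => t x t0 ttau xr; apply: (cP (t, x, H t *m x)).
have tI : t \in `[0, tau] by rewrite in_itv/= t0.
split => //=; apply: le_trans (norm_mulmx_le _ _) _.
by rewrite ler_wpM2l// ler_pM// hP.
Qed.

(** [C a] is the supremum of [S a] with 0 adjoined; the extra point makes the set nonempty and [C]
    nonnegative. *)
Lemma nondecreasing_majorant (R : realType) (S : R -> set R) :
  (forall a, has_ubound (S a)) -> (forall a b, a <= b -> S a `<=` S b) ->
  exists C : R -> R, [/\ forall a, 0 <= C a,
    forall a b : R, a <= b -> C a <= C b & forall a v : R, S a v -> v <= C a].
Proof.
move=> Sb Smono; pose S0 a := S a `|` [set 0].
have ub a : has_ubound (S0 a).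
  have [c cP] := Sb a; exists (Num.max c 0) => v [/cP vc|->].
    by rewrite le_max vc.
  by rewrite le_max lexx orbT.
exists (fun a => sup (S0 a)); split.
- by move=> a; apply: sup_ubound => //; right.
- move=> a b ab; apply: sup_le_ub; first by exists 0; right.
  move=> v [Sv|->]; apply: sup_ubound => //; [left|by right].
  exact: Smono Sv.
- by move=> a v Sv; apply: sup_ubound => //; left.
Qed.

(** * Switching times *)

(** The predecessor makes the indices 0 and 1 both give [t0], so that the first interval
    [[T 0, T 2]] starts at the initial time. *)
Definition switch_times (R : realType) (delta : R -> R) (t0 : R) (m : nat) : R :=
  iter m.-1 (fun s => s + delta s) t0.

Section SwitchTimes.
Context (R : realType) (delta : R -> R) (t0 : R).
Context (delta_gt0 : forall s, t0 <= s -> 0 < delta s).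
Context (delta_nincr : forall a b, t0 <= a -> a <= b -> delta b <= delta a).

Local Notation T := (switch_times delta t0).

Lemma switch_timesS m : T m.+2 = T m.+1 + delta (T m.+1).
Proof. by []. Qed.

Lemma switch_times_ge m : t0 <= T m.
Proof.
rewrite /switch_times; elim: m.-1 => [|i IH] /=; first exact: lexx.
by apply: (le_trans IH); rewrite lerDl ltW// delta_gt0.
Qed.

Lemma switch_times_lt m : (0 < m)%N -> T m < T m.+1.
Proof.
by case: m => // m _; rewrite switch_timesS ltrDl delta_gt0// switch_times_ge.
Qed.

Lemma switch_times_le : {homo T : i j / (i <= j)%N >-> i <= j}.
Proof.
apply: homo_leq => [x|x y z|[|i]]; [exact: lexx|exact: le_trans|exact: lexx|].
by apply/ltW/switch_times_lt.
Qed.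

(** If all times stayed below [b], every step would be at least [delta b > 0] because [delta] is
    nonincreasing, and linear growth contradicts the bound. *)
Lemma switch_times_unbounded b : exists m, b < T m.
Proof.
apply: contrapT => nb.
have Tb m : T m <= b by rewrite leNgt; apply/negP => bT; apply: nb; exists m.
have t0b : t0 <= b := Tb 0%N.
have c0 := delta_gt0 t0b.
have lin m : t0 + m%:R * delta b <= T m.+1.
  elim: m => [|m IH]; first by rewrite mul0r addr0.
  rewrite switch_timesS -natr1 mulrDl mul1r addrA lerD//.
  by apply: delta_nincr => //; exact: switch_times_ge.
pose i := Num.bound ((b - t0) / delta b).
have : (b - t0) / delta b < i%:R.
  by apply: archi_boundP; rewrite divr_ge0 ?subr_ge0// ltW.
rewrite ltr_pdivrMr// => h.
have := le_trans (lin i) (Tb i.+1); lra.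
Qed.

Lemma switch_times_cvg : T @ \oo --> +oo.
Proof.
apply/cvgryPge => b; have [m bT] := switch_times_unbounded b.
exists m => // i /= mi; apply: le_trans (ltW bT) _; exact: switch_times_le.
Qed.

(** The index is one below the first whose time exceeds [t]. Starting at [T 2] ensures [m > 1], so
    that [T m.-1 < T m] and the observer has time to approach its target. *)
Lemma switch_times_find t :
  T 2 <= t -> exists2 m, (1 < m)%N & T m <= t < T m.+1.
Proof.
move=> T2t; have ex := switch_times_unbounded t.
case: (ex_minnP ex) => m tm mmin.
have m2 : (2 < m)%N.
  rewrite ltnNge; apply/negP => /switch_times_le m2.
  by have := lt_le_trans tm (le_trans m2 T2t); rewrite ltxx.
case: m tm mmin m2 => // m tm mmin m2; exists m => //.
rewrite tm andbT leNgt; apply/negP => /mmin; by rewrite ltnn.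
Qed.

End SwitchTimes.

(** * Causal choice of an initial state *)

Definition consistent (R : realType) (n k : nat) (H : R -> 'M[R]_(k, n))
    (X : R -> R -> 'cV[R]_n -> 'cV[R]_n) (M : set 'cV[R]_n) (t0 : R)
    (y : R -> 'cV[R]_k) (s : R) : set 'cV[R]_n :=
  [set x | M x /\ forall t, t0 <= t -> t <= s -> y t = output H X t0 x t].

(** [y] enters only through the consistent set, which makes the choice causal. The slack 1 avoids
    having to attain the infimum, and comparison with the true initial state bounds the choice
    independently of [s]. *)
Definition estimate (R : realType) (n k : nat) (H : R -> 'M[R]_(k, n))
    (X : R -> R -> 'cV[R]_n -> 'cV[R]_n) (M : set 'cV[R]_n) (t0 : R)
    (y : R -> 'cV[R]_k) (s : R) : 'cV[R]_n :=
  let S := consistent H X M t0 y s in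
  xget 0 [set x | S x /\ enorm x <= inf (@enorm R n @` S) + 1].

Lemma estimate_causal (R : realType) (n k : nat) (H : R -> 'M[R]_(k, n))
    (X : R -> R -> 'cV[R]_n -> 'cV[R]_n) (M : set 'cV[R]_n) (t0 : R)
    (y1 y2 : R -> 'cV[R]_k) (s : R) :
  (forall t, t0 <= t -> t <= s -> y1 t = y2 t) ->
  estimate H X M t0 y1 s = estimate H X M t0 y2 s.
Proof.
move=> y12; rewrite /estimate.
suff -> : consistent H X M t0 y1 s = consistent H X M t0 y2 s by [].
apply/seteqP; split => x [Mx yx]; split => // t t0t ts.
  by rewrite -y12// yx.
by rewrite y12// yx.
Qed.

Lemma estimateP (R : realType) (n k : nat) (H : R -> 'M[R]_(k, n))
    (X : R -> R -> 'cV[R]_n -> 'cV[R]_n) (M : set 'cV[R]_n) (t0 : R)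
    (y : R -> 'cV[R]_k) (s : R) (x : 'cV[R]_n) :
  consistent H X M t0 y s x ->
  consistent H X M t0 y s (estimate H X M t0 y s) /\
  enorm (estimate H X M t0 y s) <= enorm x + 1.
Proof.
move=> Sx; rewrite /estimate; set S := consistent H X M t0 y s in Sx *.
have lb : has_lbound (@enorm R n @` S).
  by exists 0 => _ [z _ <-]; exact: enorm_ge0.
have infS : has_inf (@enorm R n @` S).
  by split => //; exists (enorm x); exists x.
have [_ [z Sz <-] zinf] := inf_adherent ltr01 infS.
have [] := @xgetPex _ 0 [set x | S x /\ enorm x <= inf (@enorm R n @` S) + 1].
  by exists z; split => //; exact: ltW.
move=> Sw wle; split => //; apply: le_trans wle _.
by rewrite lerD2r; apply: ge_inf => //; exists x.
Qed.

(** * Curves steering from 0 to a target *)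

(** The solution of [z' = K (v - z)] with value 0 at time [a]. *)
Definition reach (R : realType) (V : normedModType R) (K a : R) (v : V) (t : R)
    : V := (1 - expR (- (K * (t - a)))) *: v.

(** The derivative of [reach] as a function of time alone. As a right-hand side independent of the
    state, it has solutions on any interval, found by integration. *)
Definition reach_field (R : realType) (V : normedModType R) (K a : R) (v : V)
    (t : R) : V := (K * expR (- (K * (t - a)))) *: v.

Lemma reach_deriv (R : realType) (V : normedModType R) (J : set R) (K a : R)
    (v : V) (t : R) :
  deriv_within J (reach K a v) t (reach_field K a v t).
Proof.
apply: deriv_withinZl; apply: deriv_within_is_derive.
have h : is_derive t 1 (fun s => - (K * (s - a))) (- K).
  have h1 := is_deriveB (is_derive_id t 1) (is_derive_cst a t 1).
  apply: (is_derive_eq (is_deriveN (is_deriveZ K h1))).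
  by rewrite subr0 /GRing.scale/= mulr1.
have hc := @is_derive1_comp _ expR (fun s => - (K * (s - a))) t _ _
  (is_derive_expR _) h.
have h1 := is_deriveB (is_derive_cst (1 : R) t 1) hc.
apply: (is_derive_eq h1).
by rewrite sub0r mulrN opprK mulrC.
Qed.

(** The difference of the two solutions has derivative 0 on [[a, t]], which lies in the interval
    [J]; the mean value inequality with constant 0 makes it vanish. *)
Lemma reach_unique (R : realType) (n : nat) (J : set R) (K a : R)
    (v : 'cV[R]_n) (z : R -> 'cV[R]_n) :
  is_interval J -> J a -> (forall t, J t -> a <= t) ->
  solves (fun t _ => reach_field K a v t) J z -> z a = 0 ->
  forall t, J t -> z t = reach K a v t.
Proof.
move=> iJ Ja Jge zJ za t Jt.
have sub : `[a, t]%classic `<=` J.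
  by move=> u /=; rewrite in_itv/= => /andP[au ut]; apply: (iJ a t) => //; rewrite au.
have := @deriv_within_lipschitz _ _ _ a t 0 (fun s => z s - reach K a v s)
  (fun=> 0) (Jge _ Jt) (lexx _).
rewrite mul0r za /reach !subrr mulr0 oppr0 expR0 subrr scale0r !subr0.
have -> : forall u w : 'cV[R]_n, (`|u - w| <= 0) = (u == w).
  by move=> u w; rewrite normr_le0 subr_eq0.
move=> h; apply/eqP; apply: h => [u au ut|_ _ _]; last by rewrite normr0.
rewrite -(subrr (reach_field K a v u)); apply: deriv_withinB.
  by apply: (deriv_within_sub sub); apply: zJ; apply: sub; rewrite /= in_itv/= au.
exact: reach_deriv.
Qed.

(* The gain is chosen from exp (- u) <= 1 / (1 + u) at u = c |v|. *)
Lemma reach_dist (R : realType) (V : normedModType R) (a dlt c t : R) (v : V) :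
  0 < dlt -> 0 < c -> a + dlt <= t ->
  `|v - reach (c * `|v| / dlt) a v t| <= c^-1.
Proof.
move=> d0 c0 adt; rewrite /reach scalerBl scale1r opprB addrC subrK normrZ.
rewrite gtr0_norm ?expR_gt0//.
set K := _ / dlt.
have h : c * `|v| <= K * (t - a).
  rewrite /K -mulrA; apply: ler_peMr; first by rewrite mulr_ge0// ltW.
  by rewrite mulrC ler_pdivlMr// mul1r; lra.
apply: (@le_trans _ _ (expR (- (c * `|v|)) * `|v|)).
  by rewrite ler_wpM2r// ler_expR lerN2.
have h1 := expR_ge1Dx (c * `|v|).
have p0 : 0 < 1 + c * `|v| by rewrite ltr_pwDl// mulr_ge0// ltW.
rewrite expRN mulrC ler_pdivrMr ?expR_gt0//.
apply: (@le_trans _ _ (c^-1 * (1 + c * `|v|))); last first.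
  by rewrite ler_wpM2l// invr_ge0 ltW.
by rewrite mulrDr mulr1 mulKf ?gt_eqF// lerDr invr_ge0 ltW.
Qed.

Lemma reach_field_continuous (R : realType) (V : normedModType R) (K a : R)
    (v : V) : continuous (reach_field K a v).
Proof.
move=> t.
(* In this form continuity follows from the differentiability of [reach]. *)
have -> : reach_field K a v = (fun s => K *: v - K *: reach K a v s).
  apply/funext => s; rewrite /reach_field /reach scalerBl scale1r scalerBr.
  by rewrite opprB addrCA subrr addr0 scalerA.
apply: cvgB; first exact: cvg_cst.
apply: cvgZ; first exact: cvg_cst.
have := deriv_within_cvg (@reach_deriv _ _ setT K a v t).
by rewrite within_interior// interiorT.
Qed.

(** * Construction and convergence of the observer *)

Theorem proposition5p3 (R : realType) (n k : nat) (n_gt0 : (0 < n)%N)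
    (k_gt0 : (0 < k)%N)
    (F : R -> 'cV[R]_n -> 'cV[R]_k -> 'cV[R]_n) (H : R -> 'M[R]_(k, n))
    (H_cont : {within halfline 0, continuous H})
    (F_cont : {within [set p : R * 'cV[R]_n * 'cV[R]_k | 0 <= p.1.1],
                 continuous (fun p => F p.1.1 p.1.2 p.2)})
    (F_lip : locally_lipschitz_xy F)
    (M : set 'cV[R]_n) (M_neq0 : M !=set0) (M_closed : closed M) (M_0 : M 0)
    (X : R -> R -> 'cV[R]_n -> 'cV[R]_n) (X_flow : is_flow F H M X)
    (beta : R -> R -> R -> R) (X_complete : forward_complete M X beta)
    (l : nat) (l_gt0 : (0 < l)%N)
    (A : R -> 'cV[R]_l -> 'cV[R]_k -> 'M[R]_n)
    (A_cont : {within [set p : R * 'cV[R]_l * 'cV[R]_k | 0 <= p.1.1],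
                 continuous (fun p => A p.1.1 p.1.2 p.2)})
    (L : R) (L_gt1 : 1 < L)
    (hyp : forall r : R, 0 < r ->
      exists Q : R -> R -> R -> set 'cV[R]_l,
        (forall t0 xi : R, 0 <= t0 -> 0 < xi ->
          hyp_A1 F H beta A r t0 xi (Q t0 xi)) /\
        exists2 eps : R, 0 < eps &
          forall t0 xi t0' : R, 0 <= t0 -> 0 < xi -> t0 <= t0' ->
          exists (P : (R -> 'cV[R]_k) -> R -> 'M[R]_n)
            (d : (R -> 'cV[R]_k) -> R -> R),
            hyp_A2' H M X A L r eps t0 t0' (Q t0 xi) P d) :
  S_SODP H M X.
Proof.
move=> t0 t00.
have [[_ betaN1 _ betaN3] fcb] := X_complete.
have beta_mono a b c c' : 0 <= a -> a <= b -> 0 <= c -> c <= c' ->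
    beta a t0 c <= beta b t0 c'.
  move=> a0 ab c0 cc'.
  have [_ _ mono3] := betaN3 a t0 a0 t00.
  have [_ _ mono1] := betaN1 t0 c' t00 (le_trans c0 cc').
  by apply: le_trans (mono3 _ _ c0 cc') _; exact: mono1.
(* One parameter [a] bounds both the time and the initial state. For a fixed trajectory, [C a] thus
   bounds the speed up to time [a] as soon as [a >= |x0|]. *)
pose speeds (a : R) := [set v : R | exists (t : R) (x : 'cV[R]_n),
  [/\ 0 <= t, t <= a, `|x| <= beta a t0 a & v = `|F t x (H t *m x)|]].
have [C [C_ge0 C_mono C_ub]] : exists C : R -> R, [/\ forall a, 0 <= C a,
    forall a b, a <= b -> C a <= C b & forall a v, speeds a v -> v <= C a].
  apply: nondecreasing_majorant => [a|a b ab v].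
    have [c cP] := vector_field_bound a (beta a t0 a) H_cont F_cont.
    by exists c => _ [t [x [t0' ta xb ->]]]; exact: cP.
  move=> [t [x [t0' ta xb ->]]]; exists t, x; split => //.
    exact: le_trans ab.
  apply: le_trans xb _; have a0 := le_trans t0' ta.
  exact: beta_mono.
(* This gives [delta s <= 1] and [2 delta s C(s + 2) <= 2 / (1 + s)]: two steps from [s] end by
   [s + 2] and eventually move a trajectory by an amount tending to 0. *)
pose delta s := ((1 + s) * (1 + C (s + 2)))^-1.
have den_gt0 s : t0 <= s -> 0 < (1 + s) * (1 + C (s + 2)).
  by move=> t0s; rewrite mulr_gt0// ltr_pwDl//; exact: le_trans t0s.
have delta_gt0 s : t0 <= s -> 0 < delta s.
  by move=> t0s; rewrite invr_gt0 den_gt0.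
have delta_nincr a b : t0 <= a -> a <= b -> delta b <= delta a.
  move=> t0a ab; have t0b := le_trans t0a ab.
  have a0 := le_trans t00 t0a.
  rewrite lef_pV2 ?posrE ?den_gt0//.
  have := C_ge0 (a + 2); have : C (a + 2) <= C (b + 2).
    by apply: C_mono; rewrite lerD2r.
  nra.
pose T := switch_times delta t0.
have T_ge m : t0 <= T m by exact: switch_times_ge.
have T_lt m : (0 < m)%N -> T m < T m.+1 by exact: switch_times_lt.
have T_le i j : (i <= j)%N -> T i <= T j.
  by move=> ij; exact: (switch_times_le delta_gt0).
(* The estimate uses [y] only up to the left end of the interval of [g m], which makes [g]
   causal. *)
pose v y m := X (T m.-1) t0 (estimate H X M t0 y (T m.-1)).
(* At m = 1 the denominator T 1 - T 0 is 0, hence K = 0 and z_1 = 0. *)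
pose K y m := (1 + T m.-1) * `|v y m| / (T m - T m.-1).
pose g y m t (_ : 'cV[R]_n) (_ : 'cV[R]_k) :=
  reach_field (K y m) (T m.-1) (v y m) t.
exists (fun=> T), g, (fun=> [set 0]); split; last first.
  move=> m m0 y1 y2 t _ _ /=; rewrite in_itv/= => /andP[Tt _] _ y12.
  rewrite /g /K /v (@estimate_causal _ _ _ H X M t0 y1 y2)// => s t0s sT.
  by apply: y12 => //; exact: le_trans Tt.
move=> y yO.
have T_span m : (0 < m)%N -> T m.-1 < T m.+1.
  by move=> m0; apply: le_lt_trans (T_lt _ m0); apply: T_le; exact: leq_pred.
split.
- split => //; exact: switch_times_cvg.
- move=> m m0; apply: continuous_subspaceT => p.
  apply: (@continuous_comp _ _ _ (fun p : R * 'cV[R]_n * 'cV[R]_k => p.1.1)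
    (reach_field (K y m) (T m.-1) (v y m))); last exact: reach_field_continuous.
  apply: (@continuous_comp _ _ _ (fun p : R * 'cV[R]_n * 'cV[R]_k => p.1) fst);
    exact: cvg_fst.
- by exists 0.
(* [reach] solves the equation on the whole interval and coincides with [z] on [J]; maximality of
   [J] then forces equality. *)
- move=> m m0 J z [iJ Ja JT zJ zmax] z0; apply/esym.
  apply: (zmax _ (reach (K y m) (T m.-1) (v y m))) => //.
  + exact: interval_is_interval.
  + by move=> t _; exact: reach_deriv.
  + move=> t Jt; apply/esym; apply: (reach_unique iJ Ja _ _ z0 Jt) => [u|].
      by move=> /JT; rewrite /= in_itv/= => /andP[].
    exact: zJ.
- move=> z Z zP ZP x0 Mx0 yx0.
  have zE m t : (0 < m)%N -> T m <= t -> t < T m.+1 ->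
      Z t = reach (K y m) (T m.-1) (v y m) t.
    move=> m0 Tt tT; have [zm z0] := zP m m0; rewrite (ZP m)//.
    apply: (reach_unique (@interval_is_interval _ `[T m.-1, T m.+1]%R)
      _ _ zm z0).
    + by rewrite /= in_itv/= lexx ltW// T_span.
    + by move=> u; rewrite /= in_itv/= => /andP[].
    + rewrite /= in_itv/= (ltW tT) andbT; apply: le_trans Tt.
      by apply: T_le; exact: leq_pred.
  (* The radius enters only the convergence proof, not the observer; the extra 1 is the slack in
     [estimate]. *)
  pose r := enorm x0 + 1.
  have r0 : 0 < r by rewrite ltr_wpDl// enorm_ge0.
  have x0r : enorm x0 <= r by rewrite lerDl.
  have [Q [hA1 [eps eps0 hA2]]] := hyp r r0.
  have detect := detectability X_flow X_complete t00 (lt_trans ltr01 L_gt1) r0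
    (fun xi => hA1 t0 xi t00) (fun xi xi0 => hA2 t0 xi t0 t00 xi0 (lexx _))
    yO Mx0 x0r yx0.
  apply/cvgr0Pnorm_le => e e0.
  have [tau htau] := detect (e / 2) (divr_gt0 e0 (ltr0n _ 2)).
  near=> t.
  have [m m1 /andP[Tt tT]] : exists2 m, (1 < m)%N & T m <= t < T m.+1.
    apply: switch_times_find => [||]; [exact: delta_gt0|exact: delta_nincr|].
    by near: t; apply: nbhs_pinfty_ge; exact: num_real.
  have m0 : (0 < m)%N by exact: ltnW.
  set s := T m.-1.
  have t0s : t0 <= s by exact: T_ge.
  have s0 : 0 <= s by exact: le_trans t0s.
  have Ts : T m = s + delta s by rewrite /s; case: (m) m1 => [|[]].
  have TSm : T m.+1 = T m + delta (T m) by case: (m) m0.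
  (* The second step is no longer than the first, so [t - s <= 2 delta s]. *)
  have dle : delta (T m) <= delta s.
    by apply: delta_nincr => //; rewrite Ts lerDl ltW// delta_gt0.
  have ds0 := delta_gt0 _ t0s.
  have dsE : delta s * (1 + C (s + 2)) = (1 + s)^-1.
    rewrite /delta invfM -mulrA mulVf ?mulr1// gt_eqF//.
    by rewrite ltr_pwDl.
  have s1 : 0 < (1 + s)^-1 by rewrite invr_gt0 ltr_pwDl.
  have ds1 : delta s <= 1.
    have : (1 + s)^-1 <= 1 by rewrite invf_le1 ?lerDl// ltr_pwDl.
    have := C_ge0 (s + 2); nra.
  have st : s <= t by lra.
  have ts2 : t <= s + 2 * delta s by lra.
  have [Sx xr] := @estimateP _ _ _ H X M t0 y s x0
    (conj Mx0 (fun u h _ => yx0 u h)).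
  (* [v y m] is the value at [s] of a trajectory consistent with [y] on [[t0, s]], and
     [s >= t - 2 >= tau], so detectability applies. *)
  have est : `|X s t0 x0 - v y m| <= e / 2.
    rewrite distrC; apply: le_trans (norm_le_enorm _) _.
    case: Sx => Mx yx; apply: htau => //.
    have : tau + 2 <= t by near: t; apply: nbhs_pinfty_ge; exact: num_real.
    rewrite -/s; lra.
  (* The trajectory qualifies for the speed bound [C t] once [t >= r]. *)
  have var : `|X t t0 x0 - X s t0 x0| <= C t * (t - s).
    have [X0 dX] := X_flow _ _ t00 Mx0.
    apply: (@deriv_within_lipschitz _ _ _ s t _ (fun u => X u t0 x0)
      (fun u => F u (X u t0 x0) (H u *m X u t0 x0))) => // u su ut.
      apply: (@deriv_within_sub _ _ (halfline t0)); last first.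
        by apply: dX; exact: le_trans su.
      move=> w; rewrite /= in_itv/= => /andP[sw _]; exact: le_trans sw.
    apply: C_ub; exists u, (X u t0 x0).
    have t0u := le_trans t0s su; have u0 := le_trans t00 t0u.
    split => //; apply: le_trans (norm_le_enorm _) _.
    apply: le_trans (fcb _ _ _ t00 t0u Mx0) _.
    apply: (beta_mono _ _ _ _ u0 ut (enorm_ge0 _)).
    apply: le_trans x0r _; near: t; apply: nbhs_pinfty_ge; exact: num_real.
  (* The gain [K] is the one of [reach_dist] with [c = 1 + s] and [dlt = T m - s]. *)
  have dist : `|v y m - Z t| <= (1 + s)^-1.
    rewrite (zE m)//; apply: reach_dist; first by rewrite Ts addrAC subrr add0r.
      by rewrite ltr_pwDl.
    by rewrite addrC subrK.
  have Cts : C t * (t - s) <= 2 * (1 + s)^-1.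
    have Ct : C t <= C (s + 2) by apply: C_mono; lra.
    have := C_ge0 t; rewrite -dsE; nra.
  (* Two units of [(1 + s)^-1] come from the motion since [s], one from the distance of [Z t] to its
     target. *)
  have s_large : 3 * (1 + s)^-1 <= e / 2.
    rewrite ler_pdivrMr ?ltr_pwDl//.
    have : 6 / e + 2 <= t by near: t; apply: nbhs_pinfty_ge; exact: num_real.
    move=> h; have : 6 / e <= s by lra.
    rewrite ler_pdivrMr//; lra.
  rewrite -(subrKA (X s t0 x0)) -[X s t0 x0 - Z t](subrKA (v y m)).
  apply: le_trans (ler_normD _ _) _.
  apply: le_trans (lerD (lexx _) (ler_normD _ _)) _.
  lra.
Unshelve. all: by end_near. Qed.
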